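(* Let $H$ and $F$ be two fixed graphs with $\chi(H)>\chi(F)\ge 2$, let $c$ be a real number with \[ c>\frac{\chi(F)-1}{\chi(H)-1}, \] and let $\varepsilon>0$. Then there exist constants $\eta>0$ and $n_0$ such that the following holds for all $n\ge n_0$. Suppose that $G$ is an $H$-free graph on $n$ vertices and contains a vertex subset $M$ of size $m$ with \[ \frac{m}{n}\ge c \] such that $G[M]$ contains at most $\eta m^{v(F)}$ copies of $F$. Then \[ e(G)\le m(n-m)+\left(1-\frac{1}{\chi(F)-1}\right)\binom{m}{2}+\left(1-\frac{1}{\chi(H)-\chi(F)}\right)\binom{n-m}{2}+\varepsilon n^2 . \]
   Context: All graphs are finite, simple and undirected; $v(G)$ and $e(G)$ are the numbers of vertices and edges of $G$, $\chi$ is the chromatic number, and $G[M]$ is the subgraph induced by $M\subseteq V(G)$. A graph is $H$-free if it contains no (not necessarily induced) subgraph isomorphic to $H$. A copy of $F$ in a graph is a (not necessarily induced) subgraph isomorphic to $F$. *)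

(* Defs.v *)
From HB Require Import structures.
From mathcomp Require Import all_boot all_order all_algebra.
From mathcomp Require Import reals.

Set Implicit Arguments.
Unset Strict Implicit.
Unset Printing Implicit Defensive.

Record sgraph := SGraph {
  vertex :> finType;
  adj : rel vertex;
  adj_sym : symmetric adj;
  adj_irrefl : irreflexive adj
}.

Definition edges (G : sgraph) : {set {set G}} :=
  [set [set p.1; p.2] | p : G * G & adj p.1 p.2].

Section Induced.
Variables (G : sgraph) (M : {set G}).

Definition induced_adj : rel {x : G | x \in M} :=
  fun x y => adj (val x) (val y).

Fact induced_sym : symmetric induced_adj.
Proof. by move=> x y; apply: adj_sym. Qed.

Fact induced_irrefl : irreflexive induced_adj.
Proof. by move=> x; apply: adj_irrefl. Qed.

Definition induced : sgraph := SGraph induced_sym induced_irrefl.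

End Induced.

Definition colorable (G : sgraph) (k : nat) : bool :=
  [exists f : {ffun G -> 'I_k}, forall x, forall y, adj x y ==> (f x != f y)].

Fact ex_colorable (G : sgraph) : exists k, colorable G k.
Proof.
exists #|G|; apply/existsP; exists [ffun x => enum_rank x].
apply/forallP=> x; apply/forallP=> y; apply/implyP=> xy.
rewrite !ffunE; apply/eqP=> /enum_rank_inj eq_xy.
by rewrite eq_xy adj_irrefl in xy.
Qed.

Definition chi (G : sgraph) : nat := ex_minn (ex_colorable G).

(* A subgraph of G is encoded as a pair (vertex set, edge set), so that
   subgraphs with the same edges but different isolated vertices differ. *)
Definition is_subgraph (G : sgraph) (S : {set G} * {set {set G}}) : bool :=
  (S.2 \subset edges G) && [forall A in S.2, A \subset S.1].

Definition isomorphic_to (F G : sgraph) (S : {set G} * {set {set G}}) : bool :=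
  [exists f : {ffun F -> G},
    [&& injectiveb f, f @: [set: F] == S.1
      & [set f @: A | A : {set F} in edges F] == S.2]].

(* Copies are unlabelled: embeddings of F with the same image give one copy. *)
Definition copies (F G : sgraph) : {set {set G} * {set {set G}}} :=
  [set S | is_subgraph S && isomorphic_to F S].

Definition graph_free (H G : sgraph) : Prop := copies H G = set0.

(* Main.v *)
Require Import Defs.
From HB Require Import structures.
From mathcomp Require Import all_boot all_order all_algebra.
From mathcomp Require Import reals.
From mathcomp Require Import ring lra.

Set Implicit Arguments.
Unset Strict Implicit.
Unset Printing Implicit Defensive.

Import Order.TTheory GRing.Theory Num.Theory.
Local Open Scope ring_scope.

(* Write k = chi F = p + 1 and r = chi H = p + q + 1. Since F and H embed in
   blow-ups of K_k and K_r, cloning vertices one at a time (Cauchy-Schwarz) shows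
   that G[M] has o(n^k) copies of K_k and G has o(n^r) copies of K_r. Hence a
   random map from N labels to V(G), N a large constant, almost always pulls G
   back to a graph with no K_r and no K_k inside the preimage of M.

   For such a graph with vertex set A + B, let d(v) be the number of
   non-neighbours of v, v included. The weighted Caro-Wei bound yields a clique K
   with sum_{v in K} w(v) >= sum_v w(v) / d(v). Taking w = l^2 on A and w = m^2 on
   B with l >= m, together with d >= 2l - l^2 / d, gives
     sum_v d(v) >= 2 l |A| + 2 m |B| - l^2 p - m^2 q.
   This is linear in |A| and |B|, so it may be averaged over the random map; the
   choice l = N |M| / (n p), m = N (n - |M|) / (n q) is optimal, and the
   hypothesis on c says exactly that l >= m. *)

(** * Cliques and the weighted Caro-Wei bound *)

Definition clique (T : finType) (e : rel T) (K : {set T}) : bool :=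
  [forall x in K, forall y in K, (x != y) ==> e x y].

Lemma cliqueP (T : finType) (e : rel T) (K : {set T}) :
  reflect {in K &, forall x y, x != y -> e x y} (clique e K).
Proof.
apply: (iffP forall_inP) => [cK x y xK yK xy | cK x xK].
  by move/forall_inP: (cK x xK) => /(_ y yK)/implyP; apply.
by apply/forall_inP=> y yK; apply/implyP; apply: cK.
Qed.

Section CaroWei.
Variables (R : realFieldType) (T : finType) (e : rel T).
Hypotheses (e_sym : symmetric e) (e_irr : irreflexive e).

Definition codeg (S : {set T}) (x : T) : nat := #|[set y in S | ~~ e x y]|.

Lemma codeg_gt0 (S : {set T}) x : x \in S -> (0 < codeg S x)%N.
Proof. by move=> xS; apply/card_gt0P; exists x; rewrite inE xS e_irr. Qed.

(* Averaging over [v] in [S] gives a vertex [v] whose non-neighbourhood carries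
   total mass at most [w v]; put [v] in the clique and recurse on its
   neighbourhood. *)
Lemma caro_wei (w : T -> R) (S : {set T}) : (forall x, 0 <= w x) ->
  exists2 K : {set T}, (K \subset S) && clique e K &
    \sum_(x in S) w x / (codeg S x)%:R <= \sum_(x in K) w x.
Proof.
move=> w_ge0; have [n] := ubnP #|S|; elim: n => // n IHn in S *; rewrite ltnS => leS.
have [->|S_n0] := eqVneq S set0.
  exists set0; last by rewrite !big_set0.
  by rewrite sub0set; apply/cliqueP=> x y; rewrite inE.
pose g x := w x / (codeg S x)%:R.
have g_ge0 x : 0 <= g x by rewrite divr_ge0.
have [v vS gv] : exists2 v, v \in S & \sum_(x in S | ~~ e v x) g x <= w v.
  apply/exists_inP; apply: contraT => /exists_inPn gS.
  have [v0 v0S] := set0Pn _ S_n0.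
  suff: \sum_(v in S) w v < \sum_(v in S) w v by rewrite ltxx.
  rewrite [X in _ < X](_ : _ = \sum_(v in S) \sum_(x in S | ~~ e v x) g x).
    apply: ltr_sum => [|v vS]; first by apply/hasP; exists v0; rewrite ?mem_index_enum.
    by rewrite ltNge gS.
  (* After the exchange [g x] occurs once per non-neighbour of [x], that is [codeg S x] times, which
     restores [w x]; the assumed strict inequality then contradicts itself. *)
  rewrite (exchange_big_dep (mem S)) /=; last by move=> ? ? _ /andP[].
  apply: eq_bigr => x xS.
  rewrite (eq_bigl (fun v => v \in [set y in S | ~~ e x y])); last first.
    by move=> v; rewrite inE xS e_sym.
  rewrite sumr_const -/(codeg S x) -mulr_natr mulfVK //.
  by rewrite pnatr_eq0 -lt0n codeg_gt0.
pose S' := [set x in S | e v x].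
have sS'S : S' \subset S by apply/subsetP=> x; rewrite inE => /andP[].
have ltS' : (#|S'| < #|S|)%N.
  by apply/proper_card/properP; split=> //; exists v; rewrite // inE vS e_irr.
have [K /andP[sKS' cK] leK] := IHn S' (leq_trans ltS' leS).
have vK : v \notin K by apply/negP=> /(subsetP sKS'); rewrite inE e_irr andbF.
exists (v |: K).
  rewrite subUset sub1set vS (subset_trans sKS' sS'S) /=.
  apply/cliqueP=> x y; rewrite !inE => /orP[/eqP->|xK] /orP[/eqP->|yK].
  - by rewrite eqxx.
  - by move/(subsetP sKS'): yK; rewrite inE => /andP[].
  - by rewrite e_sym; move/(subsetP sKS'): xK; rewrite inE => /andP[].
  - exact: (cliqueP _ _ cK).
(* Non-neighbours of [v] are paid for by [w v]; for neighbours, passing from [S] to [S'] can only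
   shrink the codegree and so enlarge the quotient. *)
rewrite big_setU1 //= (bigID (fun x => e v x)) /= addrC lerD //.
apply: le_trans leK; rewrite [leRHS](eq_bigl (fun x => (x \in S) && e v x)); last first.
  by move=> x; rewrite inE.
apply: ler_sum => x /andP[xS vx]; rewrite ler_wpM2l // lef_pV2 ?posrE ?ltr0n ?codeg_gt0 //.
  rewrite ler_nat; apply/subset_leq_card/subsetP=> y.
  by rewrite !inE => /andP[/andP[-> _]].
by rewrite inE xS.
Qed.

(* With [d] the codegree, [d >= 2 l - l ^ 2 / d]; apply [caro_wei] with weight
   [l ^ 2] on [A] and [m ^ 2] off [A]. *)
Lemma sum_codeg_ge (A : {set T}) (p q : nat) (l m : R) :
    (forall K : {set T}, K \subset A -> clique e K -> (#|K| <= p)%N) ->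
    (forall K : {set T}, clique e K -> (#|K| <= p + q)%N) -> 0 <= m <= l ->
  2 * l * #|A|%:R + 2 * m * #|~: A|%:R - l ^+ 2 * p%:R - m ^+ 2 * q%:R
    <= \sum_x (codeg setT x)%:R.
Proof.
move=> cA cT /andP[m0 ml]; have l0 := le_trans m0 ml.
pose w x := if x \in A then l ^+ 2 else m ^+ 2.
have w_ge0 x : 0 <= w x by rewrite /w; case: ifP; rewrite exprn_ge0.
have [K /andP[_ cK] leK] := caro_wei setT w_ge0.
have wK : \sum_(x in K) w x <= l ^+ 2 * p%:R + m ^+ 2 * q%:R.
  (* In this form both coefficients are non-negative because [m <= l], so the two clique bounds can
     be inserted separately. *)
  have -> : \sum_(x in K) w x
      = (l ^+ 2 - m ^+ 2) * #|K :&: A|%:R + m ^+ 2 * #|K|%:R.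
    rewrite (bigID (mem A)) /=.
    rewrite (eq_bigr (fun=> l ^+ 2)); last by rewrite /w => x /andP[_ ->].
    rewrite [X in _ + X](eq_bigr (fun=> m ^+ 2)); last first.
      by rewrite /w => x /andP[_ /negbTE->].
    rewrite (eq_bigl (fun x => x \in K :&: A)); last by move=> x; rewrite inE.
    rewrite [X in _ + X](eq_bigl (fun x => x \in K :\: A)); last first.
      by move=> x; rewrite inE andbC.
    rewrite !sumr_const -[_ *+ #|K :&: A|]mulr_natr -[_ *+ #|K :\: A|]mulr_natr.
    have /(congr1 (fun i => i%:R : R)) := cardsID A K.
    by rewrite natrD => <-; rewrite mulrBl mulrDr addrA subrK.
  have h1 : (#|K :&: A| <= p)%N.
    apply: cA; first exact: subsetIr.
    by apply/cliqueP=> x y /setIP[xK _] /setIP[yK _]; apply: (cliqueP _ _ cK).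
  have h2 := cT _ cK; move: h1 h2; rewrite -!(ler_nat R) natrD => h1 h2.
  have hlm : 0 <= l ^+ 2 - m ^+ 2 by rewrite subr_ge0 lerXn2r.
  apply: le_trans (lerD (ler_wpM2l hlm h1) (ler_wpM2l (exprn_ge0 2 m0) h2)) _.
  by rewrite mulrDr mulrBl addrA subrK.
have {}leK := le_trans leK wK.
rewrite -subr_ge0; set X := _ - _.
apply: (@le_trans _ _ (\sum_x ((codeg setT x)%:R + w x / (codeg setT x)%:R
          - 2 * (if x \in A then l else m)))).
  apply: sumr_ge0 => x _; have : 0 < (codeg setT x)%:R :> R by rewrite ltr0n codeg_gt0 ?inE.
  move: (codeg _ x)%:R => d d0.
  have -> : d + w x / d - 2 * (if x \in A then l else m)
     = (d - (if x \in A then l else m)) ^+ 2 / d.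
    by rewrite /w; case: ifP => _; field; rewrite lt0r_neq0.
  by rewrite divr_ge0 ?sqr_ge0 // ltW.
rewrite big_split sumrN big_split /= -mulr_sumr.
rewrite (_ : \sum_x (if x \in A then l else m) = l * #|A|%:R + m * #|~: A|%:R).
  rewrite (eq_bigl (fun x => x \in [set: T])) in leK; last by move=> x; rewrite inE.
  move: leK; under eq_bigl do rewrite inE.
  rewrite /X; move: #|A|%:R #|~: A|%:R (\sum_x _ / _) (\sum_x _) => a b s1 s2; clear.
  rewrite -subr_ge0 => s1_le; rewrite -subr_ge0.
  by apply: le_trans s1_le _; rewrite le_eqVlt; apply/predU1P; left; ring.
rewrite (bigID (mem A)) /= (eq_bigr (fun=> l)) => [|x ->//].
rewrite [X in _ + X](eq_bigr (fun=> m)) => [|x /negbTE->//].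
rewrite [X in _ + X](eq_bigl (fun x => x \in ~: A)); last by move=> x; rewrite inE.
by rewrite !sumr_const -[_ *+ #|A|]mulr_natr -[_ *+ #|~: A|]mulr_natr.
Qed.

End CaroWei.

(** * Averages over uniformly random maps *)

Section Average.
Variables (R : realFieldType) (V : finType).
Implicit Types I J : finType.

Definition avg I (g : {ffun I -> V} -> R) : R := (\sum_f g f) / #|V|%:R ^+ #|I|.

Lemma eq_avg I (g h : {ffun I -> V} -> R) : g =1 h -> avg g = avg h.
Proof. by move=> gh; rewrite /avg (eq_bigr h). Qed.

Lemma ler_avg I (g h : {ffun I -> V} -> R) : (forall f, g f <= h f) -> avg g <= avg h.
Proof. by move=> gh; rewrite ler_wpM2r ?ler_sum // invr_ge0 exprn_ge0. Qed.

Lemma avgD I (g h : {ffun I -> V} -> R) : avg (fun f => g f + h f) = avg g + avg h.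
Proof. by rewrite /avg big_split mulrDl. Qed.

Lemma avgZ I a (g : {ffun I -> V} -> R) : avg (fun f => a * g f) = a * avg g.
Proof. by rewrite /avg -mulr_sumr mulrA. Qed.

Lemma avg_sum I (K : finType) (P : pred K) (g : K -> {ffun I -> V} -> R) :
  avg (fun f => \sum_(i | P i) g i f) = \sum_(i | P i) avg (g i).
Proof. by rewrite /avg exchange_big /= mulr_suml. Qed.

Hypothesis V_gt0 : (0 < #|V|)%N.
Let n_neq0 : #|V|%:R != 0 :> R. Proof. by rewrite pnatr_eq0 -lt0n. Qed.

Lemma avg_cst I a : avg (fun _ : {ffun I -> V} => a) = a.
Proof.
rewrite /avg sumr_const card_ffun -[a *+ _]mulr_natr natrX mulfK //.
by rewrite expf_neq0.
Qed.

Definition upd I (f : {ffun I -> V}) (u : I) (x : V) : {ffun I -> V} :=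
  [ffun i => if i == u then x else f i].

(* [(f, x) |-> (upd f u x, f u)] is an involution. *)
Lemma sum_upd I (u : I) (g : {ffun I -> V} -> R) :
  \sum_f \sum_x g (upd f u x) = #|V|%:R * \sum_f g f.
Proof.
pose s (p : {ffun I -> V} * V) := (upd p.1 u p.2, p.1 u).
have sK : involutive s.
  case=> f x; rewrite /s /=; congr (_, _); last by rewrite ffunE eqxx.
  by apply/ffunP=> i; rewrite !ffunE; case: eqP => // ->.
rewrite pair_big /= (reindex_inj (inv_inj sK)) /=.
rewrite (eq_bigr (fun p => g p.1)) => [|[f x] _ /=]; last first.
  by congr g; exact: (congr1 fst (sK (f, x))).
rewrite -(pair_big xpredT xpredT (fun f _ => g f)) /= mulr_sumr.
by apply: eq_bigr => f _; rewrite sumr_const mulr_natl.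
Qed.

Lemma avg_upd I (u : I) (g : {ffun I -> V} -> R) :
  avg (fun f => \sum_x g (upd f u x)) = #|V|%:R * avg g.
Proof. by rewrite /avg sum_upd mulrA. Qed.

Lemma avg_eval1 I (u : I) (P : V -> R) :
  avg (fun f : {ffun I -> V} => P (f u)) = (\sum_x P x) / #|V|%:R.
Proof.
apply: (mulfI n_neq0); rewrite -(avg_upd u) mulrCA mulfV // mulr1.
under eq_avg => f do under eq_bigr => x _ do rewrite ffunE eqxx.
exact: avg_cst.
Qed.

Lemma avg_eval2 I (u v : I) (P : V -> V -> R) : u != v ->
  avg (fun f : {ffun I -> V} => P (f u) (f v)) = (\sum_x \sum_y P x y) / #|V|%:R ^+ 2.
Proof.
move=> uv; apply: (mulfI n_neq0); rewrite -(avg_upd u).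
under eq_avg => f do under eq_bigr => x _ do rewrite !ffunE eqxx eq_sym (negbTE uv).
rewrite (avg_eval1 v (fun y => \sum_x P x y)) exchange_big.
by rewrite expr2 invfM mulrCA mulVKf.
Qed.

(** Each [h] on [I] has exactly [#|V| ^ (#|J| - #|I|)] extensions to [J]: the values on the image of
    [s] are prescribed and the others are free. So a uniform map restricts to a uniform map. *)
Lemma avg_marginal I J (s : I -> J) (g : {ffun I -> V} -> R) : injective s ->
  avg (fun f : {ffun J -> V} => g [ffun i => f (s i)]) = avg g.
Proof.
move=> s_inj; have leIJ := leq_card s s_inj.
rewrite /avg (partition_big (fun f : {ffun J -> V} => [ffun i => f (s i)]) xpredT) //=.
rewrite (eq_bigr (fun h => g h *+ #|V| ^ (#|J| - #|I|))) => [|h _].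
  rewrite sumrMnl -[_ *+ (_ ^ _)]mulr_natr natrX.
  rewrite -mulrA; congr (_ * _).
  by rewrite -{2}(subnK leIJ) exprD invfM mulrA divff ?mul1r // expf_neq0.
rewrite (eq_bigr (fun=> g h)) => [|f /eqP-> //].
rewrite sumr_const; congr (_ *+ _).
pose F j : pred V := if [pick i | s i == j] is Some i then pred1 (h i) else predT.
transitivity #|family F|.
  apply: eq_card => f; apply/idP/familyP => [fh j|fF].
    have {}fh : [ffun i => f (s i)] = h by exact/eqP.
    rewrite /F; case: pickP => [i /eqP<-|_] //=.
    by rewrite inE -fh ffunE.
  suff sfh : [ffun i => f (s i)] = h by exact: (introT eqP sfh).
  apply/ffunP=> i; rewrite ffunE; move: (fF (s i)); rewrite /F.
  case: pickP => [i' /eqP/s_inj->|/(_ i)]; last by rewrite eqxx.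
  by rewrite inE => /eqP.
rewrite card_family foldrE big_map -?enumT big_enum /=.
rewrite (bigID (mem (codom s))) /= big1 => [|j /codomP[i ->]]; last first.
  by rewrite /F; case: pickP => [i' _|/(_ i)]; rewrite ?eqxx // card1.
rewrite mul1n (eq_bigr (fun=> #|V|)) => [|j js]; last first.
  rewrite /F; case: pickP => // i /eqP sij; case/negP: js; rewrite -sij; exact: codom_f.
rewrite prod_nat_const; congr (_ ^ _)%N.
by rewrite -(cardC (mem (codom s))) card_codom // addKn.
Qed.

(** The difference of the two sides is the variance of [g]. *)
Lemma sqr_avg_le I (g : {ffun I -> V} -> R) : avg g ^+ 2 <= avg (fun f => g f ^+ 2).
Proof.
rewrite -subr_ge0.
have -> : avg (fun f => g f ^+ 2) - avg g ^+ 2 = avg (fun f => (g f - avg g) ^+ 2).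
  rewrite [RHS](eq_avg (h := fun f => g f ^+ 2 + ((- 2 * avg g) * g f + avg g ^+ 2))).
    by rewrite !avgD avgZ avg_cst; move: (avg g) (avg _) => a b; ring.
  by move=> f; move: (g f) (avg g) => a b; ring.
by rewrite -[0](avg_cst I 0) ler_avg // => f; rewrite sqr_ge0.
Qed.

(* Adding a twin [v] of [u]. *)
Lemma clone_avg I (u v : I) (g : {ffun I -> V} -> R) : u != v ->
    (forall f x, g (upd f v x) = g f) ->
  avg g ^+ 2 <= avg (fun f => g f * g (upd f u (f v))).
Proof.
move=> uv gv; pose A f := \sum_x g (upd f u x).
have Au f x : A (upd f u x) = A f.
  apply: eq_bigr => y _; congr g; apply/ffunP=> i; rewrite !ffunE.
  by case: eqP.
have n2_gt0 : 0 < #|V|%:R ^+ 2 :> R by rewrite exprn_gt0 // ltr0n.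
rewrite -(ler_pM2l n2_gt0) -exprMn -(avg_upd u).
(* Cauchy-Schwarz for [A], the sum of [g] over coordinate [u]. Up to the factor [#|V|], the mean of
   [A ^ 2] is that of [g] times [g] with [u] resampled; as [g] ignores coordinate [v], the fresh
   value can be taken to be [f v]. *)
apply: le_trans (sqr_avg_le _) _.
rewrite (eq_avg (h := fun f => \sum_x g (upd f u x) * A (upd f u x))); last first.
  by move=> f; rewrite expr2 mulr_suml; apply: eq_bigr => x _; rewrite Au.
rewrite (avg_upd u (fun f => g f * A f)) expr2 -mulrA ler_wpM2l //.
rewrite -(avg_upd v) (eq_avg (h := fun f => g f * A f)) //.
move=> f; rewrite /A mulr_sumr; apply: eq_bigr => x _.
rewrite gv ffunE eqxx; congr (_ * _).
rewrite -[RHS](gv _ x); congr g; apply/ffunP=> i; rewrite !ffunE.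
by case: (eqVneq i v) => [->|//]; rewrite ?eqxx eq_sym (negbTE uv).
Qed.

End Average.

(** * Homomorphism densities and blow-ups of cliques *)

Definition hom (I V : finType) (a : rel I) (e : rel V) (f : {ffun I -> V}) : bool :=
  [forall u, forall v, a u v ==> e (f u) (f v)].

Lemma homP (I V : finType) (a : rel I) (e : rel V) (f : {ffun I -> V}) :
  reflect (forall u v, a u v -> e (f u) (f v)) (hom a e f).
Proof.
apply: (iffP forallP) => [hf u v auv | hf u].
  by move/forallP: (hf u) => /(_ v)/implyP; apply.
by apply/forallP=> v; apply/implyP; apply: hf.
Qed.

Section HomDensity.
Variables (R : realFieldType) (V : finType) (e : rel V).
Hypothesis V_gt0 : (0 < #|V|)%N.

Definition hdens (I : finType) (a : rel I) : R :=
  avg (fun f : {ffun I -> V} => (hom a e f)%:R).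

Lemma hdens_ge0 (I : finType) (a : rel I) : 0 <= hdens a.
Proof. by rewrite -[0](avg_cst V_gt0 I 0) ler_avg // => f; rewrite ler0n. Qed.

(** Vertices outside [D] are isolated, so [D] can grow while the index type, and with it the space
    of random maps, stays fixed. *)
Definition multipart (I : finType) (k : nat) (col : I -> 'I_k) (D : {set I}) : rel I :=
  fun u v => [&& u \in D, v \in D & col u != col v].

(** The new vertex [v] is a twin of [u]. If [f] is a homomorphism both as it stands and with [u]
    moved to [f v], it respects every edge at [v]; [u] and [v] share a colour, so no edge joins
    them. Then [clone_avg] applies. *)
Lemma hdens_clone (I : finType) (k : nat) (col : I -> 'I_k) (D : {set I}) u v :
    u \in D -> v \notin D -> col u = col v ->
  hdens (multipart col D) ^+ 2 <= hdens (multipart col (v |: D)).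
Proof.
move=> uD vD cuv.
have uv : u != v by apply: contraNneq vD => <-.
apply: le_trans (clone_avg V_gt0 uv _) _ => [f x|].
  congr (nat_of_bool _)%:R; apply/homP/homP => hf y z yz; have := hf y z yz;
    case/and3P: yz => yD zD _; rewrite !ffunE; case: eqP => [yv|_];
    by [rewrite -yv yD in vD | case: eqP => // zv; rewrite -zv zD in vD].
apply: ler_avg => f; rewrite -natrM mulnb ler_nat.
case: (homP _ _ f) => //= hf; case: homP => //= hf'; rewrite lt0b.
apply/homP=> y z /and3P[]; rewrite !in_setU1.
case/orP=> [/eqP->|yD] /orP[/eqP->|zD] cyz.
- by rewrite eqxx in cyz.
- have := hf' u z; rewrite /multipart uD zD cuv cyz => /(_ isT).
  by rewrite !ffunE eqxx; case: eqP => // zu; rewrite zu cuv eqxx in cyz.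
- have := hf' y u; rewrite /multipart uD yD cuv cyz => /(_ isT).
  by rewrite !ffunE eqxx; case: eqP => // yu; rewrite yu cuv eqxx in cyz.
- by apply: hf; rewrite /multipart yD zD.
Qed.

(* The colour classes of [I] are grown inside ['I_k + I], starting from one
   vertex per colour. *)
Lemma hdens_multipart (I : finType) (k : nat) (col : I -> 'I_k) :
  hdens (fun i j : 'I_k => i != j) ^+ (2 ^ #|I|) <= hdens (fun u v => col u != col v).
Proof.
pose J : finType := ('I_k + I)%type.
pose col' (u : J) := match u with inl i => i | inr v => col v end.
pose D (E : {set I}) : {set J} := [set u | match u with inl _ => true | inr v => v \in E end].
have grow (E : {set I}) :
    hdens (fun i j : 'I_k => i != j) ^+ (2 ^ #|E|) <= hdens (multipart col' (D E)).
  have [n] := ubnP #|E|; elim: n => // n IHn in E *; rewrite ltnS => leE.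
  have [->|[v vE]] := set_0Vmem E.
    rewrite cards0 expr1 /hdens.
    rewrite -(avg_marginal V_gt0 (fun f => (hom (fun i j => i != j) e f)%:R) (@inl_inj 'I_k I)).
    apply: ler_avg => f; rewrite ler_nat; case: homP => //= hf; rewrite lt0b.
    apply/homP=> -[i|v] [j|w]; rewrite /multipart ?inE //= => ij.
    by have := hf i j ij; rewrite !ffunE.
  have vE' : v \notin E :\ v by rewrite !inE eqxx.
  rewrite -(setD1K vE) cardsU1 vE' expnS mulnC exprM.
  have -> : D (v |: E :\ v) = (inr v : J) |: D (E :\ v).
    by apply/setP=> -[i|w]; rewrite !inE.
  apply: le_trans (@hdens_clone J k col' _ (inl (col v)) (inr v) _ _ _) => //; last 2 first.
  - by rewrite inE.
  - by rewrite inE.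
  rewrite lerXn2r ?nnegrE ?exprn_ge0 ?hdens_ge0 // IHn //.
  by rewrite (cardsD1 v E) vE in leE.
(* Forgetting the [k] starting vertices only drops constraints. *)
rewrite -cardsT; apply: le_trans (grow setT) _; rewrite /hdens.
rewrite -(avg_marginal V_gt0 (fun f => (hom (fun u v => col u != col v) e f)%:R) (@inr_inj 'I_k I)).
apply: ler_avg => f; rewrite ler_nat; case: homP => //= hf; rewrite lt0b.
apply/homP=> u v uv; rewrite !ffunE; apply: hf.
by rewrite /multipart !inE.
Qed.

(** Union bound over ordered pairs of distinct indices, each colliding with probability
    [1 / #|V|]. *)
Lemma avg_noninj_le (I : finType) :
  avg (fun f : {ffun I -> V} => (~~ injectiveb f)%:R) <= #|I|%:R ^+ 2 / #|V|%:R :> R.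
Proof.
apply: (@le_trans _ _ (avg (fun f : {ffun I -> V} =>
          \sum_(p : I * I | p.1 != p.2) (f p.1 == f p.2)%:R))).
  apply: ler_avg => f; case: injectiveP => [_|f_ninj]; first exact: sumr_ge0.
  have [[u v] /= /andP[uv fuv]] : exists p : I * I, (p.1 != p.2) && (f p.1 == f p.2).
    apply/existsP; apply: contraT => /existsPn nf; case: f_ninj => u v fuv.
    by apply/eqP; move: (nf (u, v)); rewrite negb_and /= fuv eqxx orbF negbK.
  by rewrite (bigD1 (u, v)) //= fuv lerDl sumr_ge0.
rewrite avg_sum (eq_bigr (fun=> #|V|%:R^-1)) => [|[u v] /= uv]; last first.
  rewrite (avg_eval2 V_gt0 (fun x y => (x == y)%:R) uv).
  rewrite (eq_bigr (fun=> 1)) => [|x _]; last first.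
    by rewrite (bigD1 x) //= eqxx big1 ?addr0 // => y; rewrite eq_sym => /negbTE->.
  by rewrite sumr_const expr2 invfM mulVKf // pnatr_eq0 -lt0n.
rewrite sumr_const -[_ *+ _]mulr_natl ler_wpM2r ?invr_ge0 ?ler0n //.
by rewrite -natrX ler_nat -mulnn -card_prod max_card.
Qed.

End HomDensity.

(** * From copies to homomorphism densities *)

Section Copies.
Variables (R : realFieldType) (F G : sgraph).

Let img (f : {ffun F -> G}) : {set G} * {set {set G}} :=
  (f @: [set: F], [set f @: A | A : {set F} in edges F]).

Lemma img_copy (f : {ffun F -> G}) :
  injectiveb f -> hom (@adj F) (@adj G) f -> img f \in copies F G.
Proof.
move=> f_inj /homP f_hom; rewrite inE; apply/andP; split; last first.
  by apply/existsP; exists f; rewrite f_inj !eqxx.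
apply/andP; split=> /=.
  apply/subsetP=> _ /imsetP[_ /imsetP[[x y] xy ->] ->] /=; apply/imsetP.
  exists (f x, f y); first by rewrite inE; apply: f_hom; rewrite inE in xy.
  by rewrite imsetU1 imset_set1.
by apply/forall_inP=> _ /imsetP[A _ ->]; apply: imsetS; apply: subsetT.
Qed.

(** An injective homomorphism whose image is a given copy maps into the vertex set of that copy,
    which has [#|F|] elements; this leaves at most [#|F| ^ #|F|] maps per copy. *)
Lemma card_inj_hom_le :
  (#|[set f : {ffun F -> G} | injectiveb f && hom (@adj F) (@adj G) f]|
     <= #|copies F G| * #|F| ^ #|F|)%N.
Proof.
set S := [set f | _].
rewrite -sum1_card (partition_big img (mem (copies F G))) /=; last first.
  by move=> f; rewrite inE => /andP[]; apply: img_copy.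
rewrite -sum_nat_const; apply: leq_sum => C; rewrite inE.
move=> /andP[_ /existsP[h /and3P[/injectiveP h_inj /eqP hC _]]].
have <- : #|ffun_on (mem C.1) : {pred {ffun F -> G}}| = (#|F| ^ #|F|)%N.
  by rewrite card_ffun_on -hC card_imset // cardsT.
rewrite sum1_card; apply/subset_leq_card/subsetP=> f /andP[_ /eqP fC].
by apply/ffun_onP=> x; rewrite -fC /= imset_f.
Qed.

(** Non-injective homomorphisms are rare, and injective ones are charged to copies. *)
Lemma hdens_adj_le : (0 < #|G|)%N ->
  hdens R (@adj G) (@adj F)
    <= #|F|%:R ^+ 2 / #|G|%:R + (#|copies F G| * #|F| ^ #|F|)%:R / #|G|%:R ^+ #|F|.
Proof.
move=> G_gt0; apply: le_trans (lerD (avg_noninj_le R G_gt0 F) (lexx _)).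
rewrite addrC -lerBlDr.
apply: (@le_trans _ _ (avg (fun f : {ffun F -> G} =>
          (injectiveb f && hom (@adj F) (@adj G) f)%:R))); last first.
  rewrite /avg ler_wpM2r ?invr_ge0 ?exprn_ge0 // -natr_sum ler_nat.
  apply: leq_trans card_inj_hom_le; rewrite -sum1_card [leqRHS]big_mkcond /=.
  by apply: leq_sum => f _; rewrite inE; case: andP.
rewrite lerBlDr -avgD; apply: ler_avg => f.
by rewrite -natrD ler_nat; case: injectiveb; case: hom.
Qed.
End Copies.

(** A [k]-colouring makes [F] a subgraph of a complete multipartite graph on its own vertices. Hence
    few copies of [F] in a large [G] force few [k]-cliques. *)
Lemma hdens_clique_le (R : realFieldType) (F G : sgraph) (k : nat) :
    colorable F k -> (0 < #|G|)%N ->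
  hdens R (@adj G) (fun i j : 'I_k => i != j) ^+ (2 ^ #|F|)
    <= #|F|%:R ^+ 2 / #|G|%:R + (#|copies F G| * #|F| ^ #|F|)%:R / #|G|%:R ^+ #|F|.
Proof.
move=> /existsP[col /forallP col_ok] G_gt0.
apply: le_trans (hdens_multipart _ _ G_gt0 col) _.
apply: le_trans (hdens_adj_le R F G_gt0).
apply: ler_avg => f; rewrite ler_nat; case: homP => //= hf; rewrite lt0b.
apply/homP=> u v uv; apply: hf.
by move/forallP: (col_ok u) => /(_ v)/implyP; apply.
Qed.

(** * Labelled cliques and ordered edges *)

Lemma clique_ffun (T : finType) (e : rel T) (K : {set T}) (k : nat) :
    clique e K -> (k <= #|K|)%N ->
  exists2 s : {ffun 'I_k -> T}, (forall i, s i \in K) & hom (fun i j => i != j) e s.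
Proof.
move=> /cliqueP cK leK.
pose s := [ffun i : 'I_k => enum_val (widen_ord leK i)].
have sK i : s i \in K by rewrite ffunE enum_valP.
exists s => //; apply/homP=> i j ij; apply: cK => //; rewrite !ffunE.
by apply: contra_neq ij => /enum_val_inj/(congr1 val) /= ij; apply: val_inj.
Qed.

(** Each edge comes from the two ordered pairs [(x, y)] and [(y, x)], distinct since there are no
    loops. *)
Lemma card_edges_le (G : sgraph) :
  (2 * #|edges G| <= \sum_(x : G) \sum_(y : G) adj x y)%N.
Proof.
have -> : (\sum_(x : G) \sum_(y : G) adj x y = #|[set p : G * G | adj p.1 p.2]|)%N.
  by rewrite pair_bigA -sum1_card [RHS]big_mkcond; apply: eq_bigr => p _; rewrite inE; case: adj.
rewrite -[leqRHS]sum1_card (partition_big (fun p : G * G => [set p.1; p.2]) (mem (edges G))) /=.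
  rewrite mulnC -sum_nat_const; apply: leq_sum => E /imsetP[[x y]]; rewrite inE /= => xy ->.
  rewrite sum1_card (@leq_trans #|[set (x, y); (y, x)]|) //.
    rewrite cards2 xpair_eqE; case: eqP => //= exy.
    by rewrite exy adj_irrefl in xy.
  apply/subset_leq_card/subsetP=> p; rewrite !inE unfold_in.
  by case/orP=> /eqP->; rewrite inE /= ?xy ?[adj y x]adj_sym ?xy // setUC eqxx.
by move=> p pE; apply/imsetP; exists p; rewrite // inE in pE *.
Qed.

(** * Pulling the graph back along a random map *)

Section Sampling.
Variables (R : realFieldType) (G : sgraph) (M : {set G}).
Hypothesis G_gt0 : (0 < #|G|)%N.

Definition clique_in (k : nat) (f : {ffun 'I_k -> G}) : bool :=
  hom (fun i j => i != j) (@adj G) f && [forall i, f i \in M].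

(** Composition with the inclusion of [M] reaches every tuple counted on the left, and dividing by a
    power of [#|G|] rather than of [#|M|] can only lower the average. *)
Lemma clique_in_dens_le (k : nat) : (0 < #|M|)%N ->
  avg (fun f : {ffun 'I_k -> G} => (clique_in f)%:R)
    <= hdens R (@adj (induced M)) (fun i j : 'I_k => i != j).
Proof.
move=> M_gt0; pose V := induced M.
have cardV : #|V| = #|M| by rewrite card_sig.
rewrite /hdens /avg -!natr_sum cardV.
have cnt (I : finType) (P : pred I) : (\sum_i P i = #|P|)%N.
  by rewrite -sum1_card [RHS]big_mkcond; apply: eq_bigr => i _; rewrite unfold_in; case: (P i).
rewrite !cnt; pose vl (g : {ffun 'I_k -> V}) : {ffun 'I_k -> G} := [ffun i => val (g i)].
apply: (@le_trans _ _ (#|hom (fun i j : 'I_k => i != j) (@adj V)|%:R / #|G|%:R ^+ #|'I_k|)).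
  rewrite ler_wpM2r ?invr_ge0 ?exprn_ge0 // ler_nat.
  apply: leq_trans (leq_image_card vl _); apply/subset_leq_card/subsetP=> f.
  rewrite unfold_in => /andP[/homP hf /forallP fM].
  apply/imageP; exists [ffun i => exist _ (f i) (fM i) : V].
    by rewrite unfold_in; apply/homP=> i j ij; rewrite !ffunE; apply: hf.
  by apply/ffunP=> i; rewrite !ffunE.
rewrite ler_wpM2l // lef_pV2 ?posrE ?exprn_gt0 ?ltr0n //.
by rewrite lerXn2r ?nnegrE // ler_nat max_card.
Qed.

Variables (p q N : nat).

(** A count rather than an event: it vanishes exactly when the sample has none of the forbidden
    cliques, and its mean bounds the probability of the opposite. *)
Definition bad (f : {ffun 'I_N -> G}) : nat :=
  (\sum_(s : {ffun 'I_(p + q).+1 -> 'I_N})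
      hom (fun i j => i != j) (@adj G) [ffun i => f (s i)]
   + \sum_(s : {ffun 'I_p.+1 -> 'I_N}) clique_in [ffun i => f (s i)])%N.

(** For injective [s] the composite is again uniform; for other [s] the term is 0, as [P] would
    require a loop. There are [N ^ k] maps [s]. *)
Lemma avg_sample_le (k : nat) (P : pred {ffun 'I_k -> G}) :
    (forall f, P f -> hom (fun i j => i != j) (@adj G) f) ->
  avg (fun f : {ffun 'I_N -> G} =>
         \sum_(s : {ffun 'I_k -> 'I_N}) (P [ffun i => f (s i)])%:R)
    <= N%:R ^+ k * avg (fun f => (P f)%:R) :> R.
Proof.
move=> Phom.
have avgP_ge0 : 0 <= avg (fun f : {ffun 'I_k -> G} => (P f)%:R) :> R.
  by rewrite mulr_ge0 ?invr_ge0 ?exprn_ge0 ?sumr_ge0.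
rewrite avg_sum (_ : N%:R ^+ k = #|{: {ffun 'I_k -> 'I_N}}|%:R); last first.
  by rewrite card_ffun !card_ord natrX.
rewrite mulr_natl -sumr_const; apply: ler_sum => s _.
have [s_inj|s_ninj] := boolP (injectiveb s).
  by rewrite (avg_marginal G_gt0 (fun f => (P f)%:R) (injectiveP _ s_inj)).
apply: le_trans avgP_ge0; rewrite -[leRHS](avg_cst G_gt0 'I_N 0); apply: ler_avg => f.
case: (boolP (P _)) => // /Phom/homP hf; case/injectiveP: s_ninj => i j sij.
apply/eqP; apply: contraT => /(hf i j); rewrite !ffunE sij.
by rewrite adj_irrefl.
Qed.

Lemma avg_bad_le :
  avg (fun f => (bad f)%:R)
    <= N%:R ^+ (p + q).+1 * hdens R (@adj G) (fun i j : 'I_(p + q).+1 => i != j)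
    + N%:R ^+ p.+1 * avg (fun f : {ffun 'I_p.+1 -> G} => (clique_in f)%:R).
Proof.
rewrite (eq_avg (h := fun f =>
    \sum_(s : {ffun 'I_(p + q).+1 -> 'I_N})
       (hom (fun i j => i != j) (@adj G) [ffun i => f (s i)])%:R
    + \sum_(s : {ffun 'I_p.+1 -> 'I_N}) (clique_in [ffun i => f (s i)])%:R)).
  rewrite avgD; apply: lerD; first exact: avg_sample_le.
  by apply: avg_sample_le => f /andP[].
by move=> f; rewrite natrD !natr_sum.
Qed.

(** If [bad f = 0], this is [sum_codeg_ge]. Otherwise the left side is at most [2 * N ^ 2], by
    [l <= N], and the last term absorbs it. *)
Lemma sample_codeg_ge (l m : R) (f : {ffun 'I_N -> G}) : 0 <= m <= l -> l <= N%:R ->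
  \sum_i (2 * m + 2 * (l - m) * (f i \in M)%:R) - l ^+ 2 * p%:R - m ^+ 2 * q%:R
    <= \sum_i \sum_j (1 - (adj (f i) (f j))%:R) + 2 * N%:R ^+ 2 * (bad f)%:R.
Proof.
move=> ml lN; have /andP[m0 leml] := ml; have l0 := le_trans m0 leml.
pose e i j := adj (f i) (f j); pose A := [set i | f i \in M].
have sumA : \sum_i (2 * m + 2 * (l - m) * (f i \in M)%:R)
    = 2 * l * #|A|%:R + 2 * m * #|~: A|%:R.
  rewrite (bigID (mem A)) /= (eq_bigr (fun=> 2 * l)) => [|i]; last first.
    by rewrite inE => ->; rewrite mulr1; ring.
  rewrite [X in _ + X](eq_bigr (fun=> 2 * m)) => [|i]; last first.
    by rewrite inE => /negbTE->; rewrite mulr0 addr0.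
  rewrite [X in _ + X](eq_bigl (fun x => x \in ~: A)); last by move=> x; rewrite in_setC.
  by rewrite !sumr_const -[_ *+ #|A|]mulr_natr -[_ *+ #|~: A|]mulr_natr.
have codegE : \sum_i \sum_j (1 - (adj (f i) (f j))%:R) = \sum_i (codeg e setT i)%:R :> R.
  apply: eq_bigr => i _; rewrite /codeg -sum1_card natr_sum [RHS]big_mkcond /=.
  by apply: eq_bigr => j _; rewrite !inE /e; case: adj; rewrite ?subrr ?subr0.
have codeg_ge0 : 0 <= \sum_i (codeg e setT i)%:R :> R by apply: sumr_ge0.
have e_sym : symmetric e by move=> i j; apply: adj_sym.
have e_irr : irreflexive e by move=> i; apply: adj_irrefl.
rewrite codegE.
have [bad0|bad_gt0] := posnP (bad f); last first.
  apply: (@le_trans _ _ (2 * N%:R ^+ 2 * 1)); last first.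
    apply: le_trans (_ : _ <= 2 * N%:R ^+ 2 * (bad f)%:R) _; last by rewrite lerDr.
    by rewrite ler_wpM2l ?mulr_ge0 ?exprn_ge0 // ler1n.
  apply: (@le_trans _ _ (\sum_(i < N) 2 * N%:R)); last first.
    by rewrite sumr_const card_ord -[_ *+ N]mulr_natr mulr1 expr2 mulrA.
  rewrite -addrA -opprD lerBlDr -[leLHS]addr0 lerD //; last first.
    by rewrite addr_ge0 // mulr_ge0 ?exprn_ge0.
  apply: ler_sum => i _; apply: (@le_trans _ _ (2 * l)); last by rewrite ler_wpM2l.
  by case: (f i \in M); rewrite ?mulr1 ?mulr0; lra.
have clique_bad (K : {set 'I_N}) k : clique e K -> (k < #|K|)%N ->
    exists2 s : {ffun 'I_k.+1 -> 'I_N}, forall i, s i \in K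
      & hom (fun i j => i != j) (@adj G) [ffun i => f (s i)].
  move=> cK ltkK; have [s sK /homP hs] := clique_ffun cK ltkK; exists s => //.
  by apply/homP=> i j ij; rewrite !ffunE; apply: hs.
rewrite bad0 mulr0 addr0; move/eqP: bad0.
rewrite addn_eq0 !sum_nat_eq0 => /andP[/forallP no1 /forallP no2].
rewrite sumA.
apply: sum_codeg_ge => // [K KA|K] cK; rewrite leqNgt; apply/negP.
  move=> /(clique_bad _ _ cK)[s sK hs]; move: (no2 s) => /=.
  rewrite eqb0 /clique_in hs /= => /forallP[] i; rewrite ffunE.
  by move/(subsetP KA): (sK i); rewrite inE.
by move=> /(clique_bad _ _ cK)[s sK hs]; move: (no1 s) => /=; rewrite hs.
Qed.

(** [rho] is the edge density over ordered pairs, [x] the proportion of vertices in [M], and [B] the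
    bound on the mean of [bad]. *)
Let rho : R := (\sum_(x : G) \sum_(y : G) (adj x y)%:R) / #|G|%:R ^+ 2.
Let x : R := #|M|%:R / #|G|%:R.
Let B : R := N%:R ^+ (p + q).+1 * hdens R (@adj G) (fun i j : 'I_(p + q).+1 => i != j)
  + N%:R ^+ p.+1 * avg (fun f : {ffun 'I_p.+1 -> G} => (clique_in f)%:R).

Lemma avg_codeg_ge (l m : R) : 0 <= m <= l -> l <= N%:R ->
  2 * m * N%:R + 2 * (l - m) * x * N%:R - l ^+ 2 * p%:R - m ^+ 2 * q%:R
    <= N%:R ^+ 2 - (N%:R ^+ 2 - N%:R) * rho + 2 * N%:R ^+ 2 * B.
Proof.
move=> ml lN; have := ler_avg (fun f => sample_codeg_ge f ml lN).
rewrite [leRHS]avgD avgZ => le1; have := le_trans le1 (lerD (lexx _) (ler_wpM2l _ avg_bad_le)).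
rewrite mulr_ge0 ?exprn_ge0 // => /(_ isT); rewrite -/B => {le1}.
rewrite (eq_avg (h := fun f => \sum_i (2 * m + 2 * (l - m) * (f i \in M)%:R)
  + (- l ^+ 2 * p%:R - m ^+ 2 * q%:R))); last by move=> f; rewrite mulNr addrA.
rewrite avgD (avg_cst G_gt0) avg_sum.
under eq_bigr => i _ do rewrite avgD (avg_cst G_gt0) avgZ
  (avg_eval1 G_gt0 i (fun y => (y \in M)%:R)).
have -> : \sum_(y : G) (y \in M)%:R = #|M|%:R :> R.
  by rewrite -natr_sum -sum1_card [in RHS]big_mkcond.
rewrite -/x sumr_const card_ord -[_ *+ N]mulr_natr.
rewrite avg_sum; under [in X in _ <= X]eq_bigr => i _ do rewrite avg_sum.
(* The diagonal term is 1, and each of the other [N - 1] terms averages to [1 - rho]. *)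
rewrite [in X in _ <= X](eq_bigr (fun=> N%:R - (N%:R - 1) * rho)) => [|i _]; last first.
  rewrite (bigD1 i) //= (eq_avg (h := fun=> 1)) => [|f]; last first.
    by rewrite adj_irrefl subr0.
  rewrite (avg_cst G_gt0) (eq_bigr (fun=> 1 - rho)) => [|j ji]; last first.
    rewrite (eq_avg (h := fun f => 1 + -1 * (adj (f i) (f j))%:R)) => [|f]; last first.
      by rewrite mulN1r.
    rewrite avgD (avg_cst G_gt0) avgZ mulN1r; congr (1 - _).
    by rewrite (avg_eval2 G_gt0 (fun y z => (adj y z)%:R)) // eq_sym.
  rewrite sumr_const cardC1 card_ord -[_ *+ _]mulr_natr.
  have -> : N.-1%:R = N%:R - 1 :> R.
    by rewrite -subn1 natrB // (leq_ltn_trans _ (ltn_ord i)).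
  ring.
rewrite sumr_const card_ord -[_ *+ N]mulr_natr.
move: rho B x => rh b y; rewrite -subr_ge0 => h; rewrite -subr_ge0.
by apply: le_trans h _; rewrite le_eqVlt; apply/predU1P; left; ring.
Qed.

(** The optimal [l = N x / p] and [m = N (1 - x) / q] go into [avg_codeg_ge], which is divided by
    [N ^ 2]; the last hypothesis gives [m <= l]. The term [rho / N] from the diagonal is at most
    [1 / N]. *)
Lemma edge_density_le : (0 < p)%N -> (0 < q)%N -> (0 < N)%N ->
    (1 - x) / q%:R <= x / p%:R ->
  rho <= 1 - x ^+ 2 / p%:R - (1 - x) ^+ 2 / q%:R + N%:R^-1 + 2 * B.
Proof.
move=> p_gt0 q_gt0 N_gt0 x_ge.
have P : 0 < p%:R :> R by rewrite ltr0n.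
have Q : 0 < q%:R :> R by rewrite ltr0n.
have NN : 0 < N%:R :> R by rewrite ltr0n.
have gG : 0 < #|G|%:R :> R by rewrite ltr0n.
have x1 : x <= 1 by rewrite ler_pdivrMr // mul1r ler_nat max_card.
have x0 : 0 <= x by rewrite divr_ge0.
have rho1 : rho <= 1.
  rewrite ler_pdivrMr ?exprn_gt0 // mul1r -natrX -mulnn.
  under eq_bigr do rewrite -natr_sum; rewrite -natr_sum ler_nat.
  rewrite -sum_nat_const; apply: leq_sum => y _.
  by rewrite -sum1_card; apply: leq_sum => z _; case: adj.
have xp1 : x / p%:R <= 1 by rewrite ler_pdivrMr // mul1r (le_trans x1) // ler1n.
have := @avg_codeg_ge (N%:R * (x / p%:R)) (N%:R * ((1 - x) / q%:R)).
rewrite mulr_ge0 ?divr_ge0 ?subr_ge0 ?ler0n //= ler_wpM2l ?ler0n //.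
rewrite -[X in _ <= X -> _]mulr1 ler_wpM2l ?ler0n // => /(_ isT isT).
move: rho B x N%:R p%:R q%:R rho1 P Q NN => rh b y n pp qq rho1 P Q NN.
set X := (X in X <= _ -> _) => le1.
have EX : X = n ^+ 2 * (y ^+ 2 / pp + (1 - y) ^+ 2 / qq).
  by rewrite /X; field; rewrite !lt0r_neq0.
have n2 : 0 < n ^+ 2 by rewrite exprn_gt0.
move: le1; rewrite EX [leRHS](_ : _ = n ^+ 2 * (1 - (1 - n^-1) * rh + 2 * b)); last first.
  by field; rewrite lt0r_neq0.
rewrite ler_pM2l // => le1.
have h : n^-1 * rh <= n^-1 by rewrite ler_piMr // invr_ge0 ltW.
have arith (a c d : R) : a * rh <= a -> c + d <= 1 - (1 - a) * rh + 2 * b ->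
    rh <= 1 - c - d + a + 2 * b by lra.
exact: arith h le1.
Qed.

End Sampling.

(** * Choice of constants and the final estimate *)

Lemma colorable_chi (G : sgraph) : colorable G (chi G).
Proof. by rewrite /chi; case: ex_minnP. Qed.

Lemma natr_bin2 (R : realFieldType) (n : nat) : ('C(n, 2))%:R = n%:R * (n%:R - 1) / 2 :> R.
Proof.
have /(congr1 (fun i => i%:R : R)) := mul_bin_diag n 1.
case: n => [|n]; first by rewrite bin0n !mul0r.
rewrite bin1 /= !natrM => h; apply: (@mulfI _ 2); first by rewrite pnatr_eq0.
by rewrite -h -[n.+1]addn1 natrD; field.
Qed.

Lemma le_of_expX_le (R : realFieldType) (x d : R) (i : nat) :
  0 <= x -> 0 <= d -> (0 < i)%N -> x ^+ i <= d ^+ i -> x <= d.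
Proof. by move=> x0 d0 i0; rewrite ler_pXn2r. Qed.

Theorem theorem3 (R : realType) (H F : sgraph)
    (hHF : (chi F < chi H)%N) (hF : (2 <= chi F)%N)
    (c : R) (hc : ((chi F)%:R - 1) / ((chi H)%:R - 1) < c)
    (eps : R) (heps : 0 < eps) :
  exists eta : R, 0 < eta /\ exists n0 : nat,
    forall n : nat, (n0 <= n)%N ->
    forall (G : sgraph) (M : {set G}) (m : nat),
      #|G| = n -> graph_free H G -> #|M| = m ->
      c <= m%:R / n%:R ->
      #|copies F (induced M)|%:R <= eta * m%:R ^+ #|F| ->
      #|edges G|%:R <=
        m%:R * (n%:R - m%:R)
        + (1 - 1 / ((chi F)%:R - 1)) * ('C(m, 2))%:R
        + (1 - 1 / ((chi H)%:R - (chi F)%:R)) * ('C(n - m, 2))%:R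
        + eps * n%:R ^+ 2.
Proof.
have [p p_gt0 Fp] : exists2 p, (0 < p)%N & chi F = p.+1.
  by exists (chi F).-1; case: (chi F) hF => [|[]].
have [q q_gt0 Hq] : exists2 q, (0 < q)%N & chi H = (p + q).+1.
  by exists (chi H - chi F)%N; [rewrite subn_gt0 | rewrite Fp -addSn -Fp subnKC // ltnW].
have colF := colorable_chi F; have colH := colorable_chi H.
have P : 0 < p%:R :> R by rewrite ltr0n.
have Q : 0 < q%:R :> R by rewrite ltr0n.
have Fp1 : (chi F)%:R - 1 = p%:R :> R by rewrite Fp -natr1 addrK.
have Hq1 : (chi H)%:R - 1 = p%:R + q%:R :> R by rewrite Hq -natr1 addrK natrD.
have HFq : (chi H)%:R - (chi F)%:R = q%:R :> R.
  by rewrite Hq Fp -!natr1 natrD; move: (p%:R) (q%:R) => a b; ring.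
rewrite Fp1 HFq; rewrite Fp1 Hq1 in hc; rewrite Fp in colF; rewrite Hq in colH.
clear hHF hF Fp Hq Fp1 Hq1 HFq.
have c_gt0 : 0 < c by apply: le_lt_trans hc; rewrite divr_ge0 ?addr_ge0.
pose N := (Num.bound eps^-1).+1.
have NN : 0 < N%:R :> R by rewrite ltr0n.
have Neps : N%:R^-1 <= eps.
  rewrite -[eps]invrK lef_pV2 ?posrE ?invr_gt0 //.
  apply: ltW; apply: lt_le_trans (archi_boundP _) _; first by rewrite invr_ge0 ltW.
  by rewrite ler_nat.
(* Clique densities at most [d] make each of the two terms of [B] at most [eps / 8]. The powers [dF]
   and [dH] match the exponents in [hdens_clique_le]. *)
pose d := eps / (8 * N%:R ^+ (p + q).+1).
have d_gt0 : 0 < d by rewrite divr_gt0 // mulr_gt0 // exprn_gt0.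
pose dF := d ^+ (2 ^ #|F|); have dF_gt0 : 0 < dF by rewrite exprn_gt0.
pose dH := d ^+ (2 ^ #|H|); have dH_gt0 : 0 < dH by rewrite exprn_gt0.
pose C : R := (#|F| ^ #|F|)%:R.
have C_gt0 : 0 < C by rewrite ltr0n expn_gt0; case: #|F|.
(* Copies of [F] then contribute at most [dF / 2]; the other half is kept for non-injective maps. *)
exists (dF / (2 * C)); split; first by rewrite divr_gt0 // mulr_gt0.
(* The summands control, in order, the terms linear in [n], the non-injective maps from [H] to [G],
   and those from [F] to [G[M]], where [m >= c * n]. *)
pose t := 2 / eps + #|H|%:R ^+ 2 / dH + 2 * #|F|%:R ^+ 2 / (c * dF).
have t1 : 0 <= 2 / eps by rewrite divr_ge0 // ltW.
have t2 : 0 <= #|H|%:R ^+ 2 / dH by rewrite divr_ge0 ?exprn_ge0 // ltW.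
have t3 : 0 <= 2 * #|F|%:R ^+ 2 / (c * dF).
  by rewrite divr_ge0 ?mulr_ge0 ?exprn_ge0 // ltW.
exists (Num.bound t).+1 => n n0n G M m Gn Hfree Mm cmn copF.
have n_gt0 : (0 < n)%N by apply: leq_trans n0n.
have nn : 0 < n%:R :> R by rewrite ltr0n.
have tn : t <= n%:R.
  apply: ltW; apply: lt_le_trans (archi_boundP _) _; first by rewrite !addr_ge0.
  by rewrite ler_nat ltnW.
have n1 : 2 / eps <= n%:R by apply: le_trans tn; rewrite /t -addrA lerDl addr_ge0.
have n2 : #|H|%:R ^+ 2 / dH <= n%:R.
  by apply: le_trans tn; rewrite /t addrAC lerDr addr_ge0.
have n3 : 2 * #|F|%:R ^+ 2 / (c * dF) <= n%:R.
  by apply: le_trans tn; rewrite /t lerDr addr_ge0.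
have cm : c * n%:R <= m%:R by rewrite -ler_pdivlMr.
have m_gt0R : 0 < m%:R :> R by apply: lt_le_trans cm; rewrite mulr_gt0.
have m_gt0 : (0 < m)%N by rewrite ltr0n in m_gt0R.
have mn : (m <= n)%N by rewrite -Mm -Gn max_card.
have G_gt0 : (0 < #|G|)%N by rewrite Gn.
have Vm : #|induced M| = m by rewrite card_sig.
have V_gt0 : (0 < #|induced M|)%N by rewrite Vm.
have kH : hdens R (@adj G) (fun i j : 'I_(p + q).+1 => i != j) <= d.
  apply: (@le_of_expX_le _ _ _ (2 ^ #|H|) _ (ltW d_gt0)); rewrite ?hdens_ge0 ?expn_gt0 //.
  apply: le_trans (hdens_clique_le R colH G_gt0) _.
  rewrite Hfree cards0 mul0n mul0r addr0 Gn ler_pdivrMr // mulrC.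
  by rewrite -ler_pdivrMr.
have kF : avg (fun f : {ffun 'I_p.+1 -> G} => (clique_in M f)%:R) <= d.
  apply: le_trans (clique_in_dens_le R G_gt0 _ _) _; first by rewrite Mm.
  apply: (@le_of_expX_le _ _ _ (2 ^ #|F|) _ (ltW d_gt0)); rewrite ?hdens_ge0 ?expn_gt0 //.
  apply: le_trans (hdens_clique_le R colF V_gt0) _.
  rewrite Vm natrM -/C -/dF [leRHS](splitr dF); apply: lerD.
    rewrite ler_pdivrMr //; apply: le_trans (_ : dF / 2 * (c * n%:R) <= _); last first.
      by rewrite ler_wpM2l // divr_ge0 // ltW.
    have := n3; rewrite ler_pdivrMr ?mulr_gt0 //.
    by move: (#|F|%:R ^+ 2) (dF) => a b; lra.
  rewrite ler_pdivrMr ?exprn_gt0 //.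
  apply: le_trans (ler_wpM2r (ltW C_gt0) copF) _.
  rewrite le_eqVlt; apply/predU1P; left; field; exact: lt0r_neq0.
(* Equivalently [m / n >= p / (p + q)], which is where the bound on [c] enters. *)
have x_ge : (1 - #|M|%:R / #|G|%:R) / q%:R <= (#|M|%:R / #|G|%:R) / p%:R :> R.
  rewrite Mm Gn; have := lt_le_trans hc cmn.
  rewrite ltr_pdivrMr ?addr_gt0 // => px.
  rewrite ler_pdivrMr // [leRHS]mulrAC ler_pdivlMr //.
  by move: (m%:R / n%:R) (p%:R) (q%:R) px => x a b px; lra.
have := edge_density_le (R := R) G_gt0 (N := N) p_gt0 q_gt0 isT x_ge.
rewrite Mm Gn; set B := (X in 2 * X).
have leB : B <= eps / 4.
  have leNN : N%:R ^+ p.+1 <= N%:R ^+ (p + q).+1 :> R.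
    by rewrite ler_weXn2l ?ler1n // ltnS leq_addr.
  have -> : eps / 4 = N%:R ^+ (p + q).+1 * d + N%:R ^+ (p + q).+1 * d.
    by rewrite /d; field; rewrite ?expf_neq0 // lt0r_neq0.
  apply: lerD; first by rewrite ler_wpM2l ?exprn_ge0.
  apply: (@le_trans _ _ (N%:R ^+ p.+1 * d)); first by rewrite ler_wpM2l ?exprn_ge0.
  by rewrite ler_wpM2r // ltW.
have edges_le : 2 * #|edges G|%:R <= \sum_(x : G) \sum_(y : G) (adj x y)%:R :> R.
  rewrite -natrM; under eq_bigr do rewrite -natr_sum; rewrite -natr_sum ler_nat.
  exact: card_edges_le.
rewrite ler_pdivrMr ?exprn_gt0 // => /(le_trans edges_le) {edges_le}.
rewrite !natr_bin2 natrB //.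
have mnR : m%:R <= n%:R :> R by rewrite ler_nat.
have {}n1 : 2 <= n%:R * eps by rewrite -ler_pdivrMr.
(* From here [x], [y], [u], [v] stand for [m], [n], [p], [q], and [a], [b] for [1 / N] and [B]. *)
move: #|edges G|%:R (N%:R^-1) B (m%:R) (n%:R) (p%:R) (q%:R) Neps leB n1 nn P Q m_gt0R mnR.
move=> e a b x y u v aeps beps yeps y0 u0 v0 x0 xy le_e.
(* Budget in units of [eps * y ^ 2]: 1 for [a], 1/2 for [2 * b], and 1/2 for the linear term [y]. *)
have slack : (a + 2 * b) * y ^+ 2 + y <= 2 * (eps * y ^+ 2).
  have y2 : 0 <= y ^+ 2 by rewrite exprn_ge0 // ltW.
  have h1 : (a + 2 * b) * y ^+ 2 <= 3 / 2 * eps * y ^+ 2.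
    by rewrite ler_wpM2r //; lra.
  have h2 : y * 2 <= y * (y * eps) by rewrite ler_wpM2l // ltW.
  have -> : eps * y ^+ 2 = y * (y * eps) by ring.
  move: h1; have -> : 3 / 2 * eps * y ^+ 2 = 3 / 2 * (y * (y * eps)) by ring.
  lra.
(* The left side is what is lost, after doubling, when the binomials replace [x ^ 2 / 2] and
   [(y - x) ^ 2 / 2]. *)
have lin : (1 - 1 / u) * x + (1 - 1 / v) * (y - x) <= y.
  have h1 : 0 <= 1 / u * x by rewrite mulr_ge0 ?divr_ge0 // ltW.
  have h2 : 0 <= 1 / v * (y - x) by rewrite mulr_ge0 ?divr_ge0 ?subr_ge0 // ltW.
  lra.
have expand : (1 - (x / y) ^+ 2 / u - (1 - x / y) ^+ 2 / v + a + 2 * b) * y ^+ 2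
    = 2 * (x * (y - x) + (1 - 1 / u) * (x * (x - 1) / 2)
           + (1 - 1 / v) * ((y - x) * (y - x - 1) / 2))
      + ((1 - 1 / u) * x + (1 - 1 / v) * (y - x)) + (a + 2 * b) * y ^+ 2.
  by field; rewrite !lt0r_neq0.
have two : 0 < 2 :> R by [].
rewrite -(ler_pM2l two); apply: le_trans le_e _; rewrite {}expand [leRHS]mulrDr -addrA lerD2l.
by apply: le_trans slack; rewrite addrC lerD2l.
Qed.
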